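(* Let $V$ be a countable set, let $F=(V,F^1,r,s)$ be a directed graph with vertex set $V$, and let $X_F$ be its graph correspondence over $c_0(V)$. For each $u,v\in V$ let $E_{uv}$ be any orthonormal basis of the Hilbert space $p_u\cdot X_F\cdot p_v$, and let $E=(V,E^1,r_E,s_E)$ be the directed graph with edge set $E^1=\bigcup_{u,v\in V}E_{uv}$ (a disjoint union) and with $r_E(e)=u$ and $s_E(e)=v$ for $e\in E_{uv}$. Then $E$ is isomorphic to $F$ via a graph isomorphism which fixes the vertex set; that is, there is a bijection $\phi\colon E^1\to F^1$ with $r(\phi(e))=r_E(e)$ and $s(\phi(e))=s_E(e)$ for all $e\in E^1$.
   Context: $V$ is a countable set regarded as a discrete space, $c_0(V)$ is the $C^*$-algebra of complex functions on $V$ vanishing at infinity, and $p_v\in c_0(V)$ is the characteristic function of $\{v\}$. A directed graph $F=(V,F^1,r,s)$ with vertex set $V$ consists of a countable set $F^1$ of edges and arbitrary range and source maps $r,s\colon F^1\to V$. A $C^*$-correspondence over a $C^*$-algebra $A$ is a right Hilbert $A$-module $X$ (with $A$-valued inner product, conjugate-linear in the first variable) together with a left action of $A$ given by a $*$-homomorphism from $A$ into the adjointable operators on $X$. The graph correspondence $X_F$ is the $C^*$-correspondence over $c_0(V)$ given by $$X_F=\Bigl\{\xi\colon F^1\to\mathbb C \ \Bigm|\ \text{the map } v\mapsto\sum_{s(f)=v}|\xi(f)|^2 \text{ is in } c_0(V)\Bigr\},$$ with module actions and inner product $$(a\cdot\xi\cdot b)(f)=a(r(f))\,\xi(f)\,b(s(f)),\qquad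 \langle\xi,\eta\rangle(v)=\sum_{s(f)=v}\overline{\xi(f)}\,\eta(f)$$ for $a,b\in c_0(V)$, $\xi,\eta\in X_F$, $f\in F^1$, $v\in V$. For $u,v\in V$, the closed subspace $p_u\cdot X_F\cdot p_v=\{p_u\cdot\xi\cdot p_v\mid \xi\in X_F\}$ of $X_F$ is a Hilbert space with the inner product $\langle\xi,\eta\rangle_v=\langle\xi,\eta\rangle(v)\in\mathbb C$. The subspaces $p_u\cdot X_F\cdot p_v$, for distinct pairs $(u,v)$, are linearly independent, so the sets $E_{uv}$ are pairwise disjoint. *)

(* Defs.v *)
From HB Require Import structures.
From mathcomp Require Import all_boot all_order all_algebra finmap complex.
From mathcomp Require Import all_classical all_reals all_analysis.
From mathcomp.analysis.showcase Require summability.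

Set Implicit Arguments.
Unset Strict Implicit.
Unset Printing Implicit Defensive.

Import Order.TTheory GRing.Theory Num.Theory.
Import numFieldNormedType.Exports.

Local Open Scope classical_set_scope.
Local Open Scope complex_scope.
Local Open Scope ring_scope.

(* Countability of the edge set is not a field; it is a hypothesis wherever a
   graph is given. *)
Record digraph (V : Type) := Digraph {
  edge : choiceType;
  rng : edge -> V;
  src : edge -> V }.

Definition iso_fixing_vertices (V : Type) (E F : digraph V) : Prop :=
  exists phi : edge E -> edge F, bijective phi /\
    forall e, rng (phi e) = rng e /\ src (phi e) = src e.

Section c0.
Variables (R : realType) (V : choiceType).

(* In the discrete space V the compact sets are the finite ones. *)
Definition c0 : set (V -> R[i]) :=
  [set a | forall eps : R, 0 < eps -> finite_set [set v | eps%:C <= `|a v|]].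

Definition pt_proj (v : V) : V -> R[i] := \1_[set v].

End c0.

(* The values of vectors are taken in R[i]^o, which gives functions on the
   edges their R[i]-module structure and R[i] the topology of its norm. *)
Section graph_correspondence.
Variables (R : realType) (V : choiceType) (F : digraph V).
Implicit Types (xi eta : edge F -> R[i]^o) (a b : V -> R[i]).

(* Unconditional sum over the edges with source v: the limit of the net of
   partial sums indexed by the finite sets of edges. *)
Definition sum_src (v : V) (g : edge F -> R[i]^o) : R[i] :=
  summability.sum (fun f => if src f == v then g f else 0).

Definition graph_act a xi b : edge F -> R[i]^o :=
  fun f => a (rng f) * xi f * b (src f).

Definition graph_inner xi eta : V -> R[i] :=
  fun v => sum_src v (fun f => (xi f)^* * eta f).

Definition sqnorm_src xi (v : V) : \bar R :=
  (\esum_(f in [set f | src f = v]) (Normc.normc (xi f) ^+ 2)%:E)%E.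

Definition graph_corr : set (edge F -> R[i]^o) :=
  [set xi | (forall v, (sqnorm_src xi v < +oo)%E) /\
            c0 (fun v => (fine (sqnorm_src xi v))%:C)].

Definition corner (u v : V) : set (edge F -> R[i]^o) :=
  [set graph_act (pt_proj R u) xi (pt_proj R v) | xi in graph_corr].

Definition corner_inner (v : V) xi eta : R[i] := graph_inner xi eta v.

End graph_correspondence.

Section orthonormal_basis.
Variables (R : realType) (X : lmodType R[i]) (inner : X -> X -> R[i]).

Definition inner_norm (x : X) : R := Num.sqrt (complex.Re (inner x x)).

Definition lin_span (B : set X) : set X :=
  [set y | exists n (c : 'I_n -> R[i]) (b : 'I_n -> X),
     (forall i, B (b i)) /\ y = \sum_(i < n) c i *: b i].

Definition orthonormal_basis (H B : set X) : Prop :=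
  [/\ B `<=` H,
      forall x y, B x -> B y -> inner x y = (x == y)%:R &
      forall x, H x -> forall eps : R, 0 < eps ->
        exists2 y, lin_span B y & inner_norm (x - y) < eps].

End orthonormal_basis.

Section basis_graph.
Variables (R : realType) (V : choiceType) (F : digraph V).
Variable B : V -> V -> set (edge F -> R[i]^o).

(* The edge set is the union of the sets B u v, tagged by (u, v); the union is
   disjoint, see basis_disjoint. *)
Definition basis_graph : digraph V :=
  @Digraph V {uv : V * V & B uv.1 uv.2}
    (fun e => (tag e).1) (fun e => (tag e).2).

Lemma sum_src0 v : sum_src v (fun _ : edge F => 0 : R[i]^o) = 0.
Proof.
rewrite /sum_src /summability.sum.
have tF := @summability.totally_filter (edge F).
apply: (@cvg_lim (R[i]^o : normedModType R[i]) _ {fset edge F}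
  summability.totally).
  exact: norm_hausdorff.
apply: cvg_near_cst; apply: filterE => J.
by rewrite /summability.partial_sum big1// => f _; case: ifP.
Qed.

Lemma corner_supp (u v : V) (xi : edge F -> R[i]^o) (f : edge F) :
  corner u v xi -> xi f != 0 -> rng f = u /\ src f = v.
Proof.
move=> [eta _ <-]; rewrite /graph_act /pt_proj !indicE !mulf_eq0 !negb_or.
rewrite !pnatr_eq0 !eqb0 !negbK => /andP[/andP[/set_mem -> _] /set_mem ->].
by [].
Qed.

Lemma basis_disjoint :
  (forall u v, orthonormal_basis (corner_inner v) (corner u v) (B u v)) ->
  trivIset [set: V * V] (fun uv => B uv.1 uv.2).
Proof.
move=> B_onb [u v] [u' v'] _ _ [xi /= [Bxi B'xi]].
have [Bc Bo _] := B_onb u v; have [B'c _ _] := B_onb u' v'.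
have [f xif] : exists f, xi f != 0.
  apply: contrapT => /forallNP xi0.
  have {}xi0 : xi = fun=> 0.
    by apply/funext => f; apply/eqP; move: (xi0 f) => /negP; rewrite negbK.
  have := Bo _ _ Bxi Bxi; rewrite eqxx /corner_inner /graph_inner xi0.
  under [X in sum_src _ X]eq_fun do rewrite mulr0.
  by move=> /eqP; rewrite sum_src0 eq_sym oner_eq0.
have [<- <-] := corner_supp (Bc _ Bxi) xif.
by have [<- <-] := corner_supp (B'c _ B'xi) xif.
Qed.

End basis_graph.

(* Main.v *)
(* The corner p_u X_F p_v is l^2 of the set of edges from v to u. The squared
   moduli |b(f)|^2, with f in this set and b in the given orthonormal basis of
   the corner, form a doubly stochastic array: each b is a unit vector, and
   Parseval's identity for the unit vector at f gives the sum over b. Summing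
   all entries in both orders shows that the two index sets have the same
   number of elements when one of them is finite; otherwise both are countably
   infinite, since each f is in the support of only countably many b. *)

Require Import Defs.
From mathcomp Require Import all_boot all_order all_algebra complex.
From mathcomp Require Import all_classical all_reals all_analysis.
From mathcomp Require Import finmap ring lra.
From mathcomp.analysis.showcase Require summability.

Set Implicit Arguments.
Unset Strict Implicit.
Unset Printing Implicit Defensive.

Import Order.TTheory GRing.Theory Num.Theory.
Import numFieldNormedType.Exports.

Local Open Scope classical_set_scope.
Local Open Scope complex_scope.
Local Open Scope card_scope.
Local Open Scope ring_scope.

(** * Sums of nonnegative families and cardinalities of index sets *)

Section cardinality.
Local Open Scope ereal_scope.
Variable R : realType.

Lemma esum_fset_le (I : choiceType) (A : set I) (a : I -> \bar R)
    (J : {fset I}) :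
  [set` J] `<=` A -> \sum_(i <- J) a i <= \esum_(i in A) a i.
Proof.
move=> JA; apply: esum_ge; exists [set` J]; first by split.
by rewrite fsbig_finite//= set_fsetK.
Qed.

Lemma esum_ge_infinite (I : choiceType) (A : set I) (a : I -> \bar R) (c : R) :
  (0 < c)%R -> infinite_set A -> (forall i, A i -> c%:E <= a i) ->
  \esum_(i in A) a i = +oo.
Proof.
move=> c0 Ainf ca; apply: eq_infty => M.
(* More than [M / c] terms, each at least [c], already add up to at least [M]. *)
have [J JA nJ] := infinite_set_fset (Num.truncn (M / c)).+1 Ainf.
apply: le_trans (esum_fset_le a JA).
apply: (@le_trans _ _ (\sum_(i <- J) c%:E)); last first.
  by rewrite big_seq [leRHS]big_seq; apply: lee_sum => i iJ; exact/ca/JA.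
rewrite sumEFin lee_fin big_const_seq count_predT iter_addr_0.
rewrite -mulr_natr mulrC -ler_pdivrMr//.
by apply: ltW; apply: (lt_le_trans (truncnS_gt _)); rewrite ler_nat.
Qed.

(** The support is the union over [n] of the sets where the term is at least [1 / (n + 1)]. Each of
    these is finite, since infinitely many such terms would make the sum infinite. *)
Lemma countable_esum_support (I : choiceType) (A : set I) (a : I -> \bar R) :
  (forall i, A i -> 0 <= a i) -> \esum_(i in A) a i < +oo ->
  countable [set i | A i /\ a i != 0].
Proof.
move=> a0 afin.
have -> : [set i | A i /\ a i != 0] =
    \bigcup_n [set i | A i /\ (n.+1%:R^-1)%:E <= a i].
  apply/seteqP; split => [i /= [Ai ai0]|i [n _ /= [Ai ai]]]; last first.
    split => //; rewrite gt_eqF// (lt_le_trans _ ai)// lte_fin invr_gt0.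

  have {}ai0 : 0 < a i by rewrite lt0e ai0 a0.
  case aiE : (a i) => [r| |]; last by rewrite aiE in ai0.
    move: ai0; rewrite aiE lte_fin => r0.
    (* This index [n] satisfies [r^-1 < n + 1]. For an infinite term, treated below, [n = 0] will
       do. *)
    exists (Num.truncn r^-1) => //; split => //.
    rewrite aiE lee_fin invf_ple ?posrE// ?ltr0n//.
    exact/ltW/truncnS_gt.
  by exists 0%N => //; split => //; rewrite aiE leey.
apply: bigcup_countable => // n _; apply: finite_set_countable.
apply: contrapT => Dinf.
have n0 : (0 < n.+1%:R^-1 :> R)%R by rewrite invr_gt0 ltr0n.
have := esum_ge_infinite n0 Dinf (fun i Di => Di.2).
apply/eqP; rewrite lt_eqF// (le_lt_trans _ afin)//.
rewrite esum_mkcond [leRHS]esum_mkcond; apply: le_esum => i _.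
case: ifPn => [/set_mem[Ai _]|_]; first by rewrite mem_set.
by case: ifPn => // /set_mem/a0.
Qed.

Lemma esum_exchange (I J : choiceType) (A : set I) (B : set J)
    (a : I -> J -> \bar R) :
  (forall i j, A i -> B j -> 0 <= a i j) ->
  \esum_(i in A) \esum_(j in B) a i j = \esum_(j in B) \esum_(i in A) a i j.
Proof.
move=> a0; rewrite esum_esum// esum_esum; last by move=> j i Bj Ai; exact: a0.
rewrite (@reindex_esum _ _ _ (B `*`` (fun=> A)) _ (fun x => (x.2, x.1)))//.
split.
- by move=> [j i] /= [].
- by move=> [j i] [j' i'] _ _ /= [-> ->].
- by move=> [i j] /= [Ai Bj]; exists (j, i).
Qed.

Lemma finite_esum1 (I : choiceType) (A : set I) :
  finite_set A -> \esum_(i in A) 1 = #|` fset_set A|%:R%:E :> \bar R.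
Proof.
move=> Afin; rewrite esum_fset// fsbig_finite// sumEFin.
by rewrite big_const_seq count_predT iter_addr_0.
Qed.

Lemma card_eq_doubly_stochastic (I J : choiceType) (A : set I) (B : set J)
    (a : I -> J -> \bar R) :
  (forall i j, 0 <= a i j) ->
  (forall i, A i -> \esum_(j in B) a i j = 1) ->
  (forall j, B j -> \esum_(i in A) a i j = 1) ->
  countable A -> A #= B.
Proof.
move=> a0 rowE colE Acnt.
(* The total of the array, computed by rows and by columns, counts [A] and [B] respectively. *)
have AB : \esum_(i in A) (1 : \bar R) = \esum_(j in B) (1 : \bar R).
  rewrite -(eq_esum rowE) -(eq_esum colE); exact: esum_exchange.
have inf1 (K : choiceType) (D : set K) : infinite_set D ->
    \esum_(k in D) (1 : \bar R) = +oo.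
  by move=> Dinf; exact: (@esum_ge_infinite _ _ _ 1%R).
have [Afin|Ainf] := pselect (finite_set A).
  have [Bfin|Binf] := pselect (finite_set B).
    apply/fcard_eq => //; apply/eqP; rewrite -(eqr_nat R); apply/eqP.
    by move: AB; rewrite !finite_esum1// => -[].
  by move: AB; rewrite (inf1 _ B)// finite_esum1.
have [Bfin|Binf] := pselect (finite_set B).
  by move: AB; rewrite (inf1 _ A)// finite_esum1.
(* A column that sums to 1 has a nonzero entry, so [B] is covered by the supports of the rows. These
   are countably many, and each is countable because its row has a finite sum. *)
have Bcnt : countable B.
  suff: B `<=` \bigcup_(i in A) [set j | B j /\ a i j != 0].
    move=> /subset_card_le /card_le_trans; apply.
    apply: bigcup_countable => // i Ai; apply: countable_esum_support => //.
    by rewrite rowE// ltry.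
  move=> j Bj; apply: contrapT => nj.
  have aj0 i : A i -> a i j = 0.
    by move=> Ai; apply/eqP/negPn/negP => aij; apply: nj; exists i.
  by have /eqP := colE _ Bj; rewrite esum1// eq_sym onee_eq0.
have cardN (K : choiceType) (D : set K) : infinite_set D -> countable D ->
    D #= [set: nat].
  by move=> /infiniteP Dinf Dcnt; apply/card_eqPle.
exact: card_eq_trans (cardN _ _ Ainf Acnt) (card_esym (cardN _ _ Binf Bcnt)).
Qed.

End cardinality.

(** * Bessel's equality and Parseval's identity *)

Section parseval.
Variable R : realType.

(** The norm [|z|] has type [R[i]]; sums in [\bar R] require a squared modulus with values in
    [R]. *)
Definition sqnormc (z : R[i]) : R := Normc.normc z ^+ 2.

Lemma sqnormcE z : (sqnormc z)%:C = `|z| ^+ 2.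
Proof. by rewrite rmorphXn. Qed.

Lemma sqnormc_ge0 z : 0 <= sqnormc z.
Proof. exact: sqr_ge0. Qed.

(** The axioms are relative to a subset [H] of the module: [ell2_inner] is defined on all functions,
    but its sum is shown to converge only for square-summable ones. *)
Record inner_product_on (X : lmodType R[i]) (inner : X -> X -> R[i])
    (H : set X) : Prop := InnerProductOn {
  ip_set0 : H 0;
  ip_setP : forall a x y, H x -> H y -> H (a *: x + y);
  ip_linearr : forall a x y z, H x -> H y -> H z ->
    inner x (a *: y + z) = a * inner x y + inner x z;
  ip_conj : forall x y, H x -> H y -> inner y x = (inner x y)^*;
  ip_ge0 : forall x, H x -> 0 <= inner x x }.

Variables (X : lmodType R[i]) (inner : X -> X -> R[i]) (H : set X).
Hypothesis ip : inner_product_on inner H.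

Lemma ip_set_sum (I : eqType) (r : seq I) (c : I -> R[i]) (b : I -> X) :
  (forall i, i \in r -> H (b i)) -> H (\sum_(i <- r) c i *: b i).
Proof.
elim: r => [|i r IH] bH; first by rewrite big_nil; exact: ip_set0 ip.
rewrite big_cons; apply: (ip_setP ip); first by apply: bH; rewrite mem_head.
by apply: IH => j jr; apply: bH; rewrite in_cons jr orbT.
Qed.

Lemma ip_setB x y : H x -> H y -> H (x - y).
Proof.
by move=> Hx Hy; rewrite addrC -scaleN1r; exact: (ip_setP ip).
Qed.

Lemma ip0r x : H x -> inner x 0 = 0.
Proof.
move=> Hx; have H0 := ip_set0 ip.
have := ip_linearr ip (-1) Hx H0 H0.
by rewrite scaler0 addr0 mulN1r addNr.
Qed.

Lemma ip_sumr (I : eqType) (r : seq I) (c : I -> R[i]) (b : I -> X) x :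
  H x -> (forall i, i \in r -> H (b i)) ->
  inner x (\sum_(i <- r) c i *: b i) = \sum_(i <- r) c i * inner x (b i).
Proof.
move=> Hx; elim: r => [|i r IH] bH; first by rewrite !big_nil ip0r.
rewrite !big_cons (ip_linearr ip)//; last first.
- by apply: ip_set_sum => j jr; apply: bH; rewrite in_cons jr orbT.
- by apply: bH; rewrite mem_head.
by rewrite IH// => j jr; apply: bH; rewrite in_cons jr orbT.
Qed.

Lemma ipBr x y z : H x -> H y -> H z -> inner x (y - z) = inner x y - inner x z.
Proof.
move=> Hx Hy Hz.
by rewrite addrC -scaleN1r (ip_linearr ip)// mulN1r addrC.
Qed.

Lemma ip_pythagoras x y : H x -> H y -> inner x y = 0 ->
  inner (x + y) (x + y) = inner x x + inner y y.
Proof.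
move=> Hx Hy xy0.
have Hxy : H (x + y) by rewrite -[x]scale1r; exact: (ip_setP ip).
have innerD z : H z -> inner z (x + y) = inner z x + inner z y.
  by move=> Hz; rewrite -{1}[x]scale1r (ip_linearr ip)// mul1r.
rewrite innerD// (ip_conj ip Hx Hxy) (ip_conj ip Hy Hxy) !innerD//.
rewrite xy0 (ip_conj ip Hx Hy) xy0 conjC0 addr0 add0r.
by rewrite -(ip_conj ip Hx Hx) -(ip_conj ip Hy Hy).
Qed.

Variables (B : set X) (B_onb : orthonormal_basis inner H B).

Let BH : B `<=` H. Proof. by case: B_onb. Qed.

(** For [S] contained in the orthonormal basis, this is the orthogonal projection of [x] onto the
    span of [S]. *)
Definition fourier_sum (S : {fset X}) (x : X) : X :=
  \sum_(b <- S) inner b x *: b.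

Section fourier_sum.
Variables (S : {fset X}) (SB : [set` S] `<=` B) (x : X) (Hx : H x).

Let SH b : b \in S -> H b.
Proof. by move=> /SB/BH. Qed.

Lemma fourier_sum_in : H (fourier_sum S x).
Proof. exact: ip_set_sum. Qed.

Lemma fourier_sum_coef b : b \in S -> inner b (fourier_sum S x) = inner b x.
Proof.
move=> bS; rewrite ip_sumr//; last exact: SH.
case: B_onb => _ Bo _.
rewrite (bigD1_seq b)//= (Bo _ _ (SB bS) (SB bS)) eqxx mulr1.
rewrite big_seq_cond big1 ?addr0// => c /andP[cS cb].
by rewrite (Bo _ _ (SB bS) (SB cS)) eq_sym (negbTE cb) mulr0.
Qed.

(** By [fourier_sum_coef] the residual has zero coefficient at each element of [S]. The family [b]
    may repeat elements, so the lemma covers both the Fourier sum itself and an arbitrary linear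
    combination. *)
Lemma fourier_sum_orth (I : eqType) (r : seq I) (c : I -> R[i]) (b : I -> X) :
  (forall i, i \in r -> b i \in S) ->
  inner (x - fourier_sum S x) (\sum_(i <- r) c i *: b i) = 0.
Proof.
move=> rS; have HP := fourier_sum_in; have HxP := ip_setB Hx HP.
rewrite ip_sumr//; last by move=> i /rS/SH.
rewrite big_seq big1// => i /rS bS; have Hb := SH bS.
by rewrite (ip_conj ip Hb HxP) ipBr// fourier_sum_coef// subrr conjC0 mulr0.
Qed.

(** Pythagoras for the splitting of [x] into its residual and its projection. *)
Lemma bessel_eq : inner x x =
  inner (x - fourier_sum S x) (x - fourier_sum S x) +
    (\sum_(b <- S) sqnormc (inner b x))%:C.
Proof.
have HP := fourier_sum_in.
have HxP := ip_setB Hx HP.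
rewrite -[in LHS](subrK (fourier_sum S x) x) [LHS]ip_pythagoras//; last first.
  exact: fourier_sum_orth.
congr (_ + _); rewrite {2}/fourier_sum ip_sumr// rmorph_sum /=.
rewrite big_seq [RHS]big_seq; apply: eq_bigr => b bS.
by rewrite (ip_conj ip (SH bS) HP) fourier_sum_coef// sqnormcE normCK.
Qed.

(** With [y] the competing combination, [x - y] is the residual plus a vector in the span of [S].
    These are orthogonal, so the second one can only increase the norm. *)
Lemma fourier_sum_best (n : nat) (c : 'I_n -> R[i]) (b : 'I_n -> X) :
  (forall i, b i \in S) ->
  inner (x - fourier_sum S x) (x - fourier_sum S x) <=
  inner (x - \sum_(i < n) c i *: b i) (x - \sum_(i < n) c i *: b i).
Proof.
move=> bS; set y := \sum_(i < n) _.
have HP := fourier_sum_in.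
have Hy : H y by apply: ip_set_sum => i _; exact: SH.
have HxP := ip_setB Hx HP; have HPy := ip_setB HP Hy.
have zy0 : inner (x - fourier_sum S x) (fourier_sum S x - y) = 0.
  by rewrite ipBr// !fourier_sum_orth// subr0.
rewrite -(subrKA (fourier_sum S x) x (- y)) [leRHS]ip_pythagoras//.
by rewrite lerDl (ip_ge0 ip).
Qed.

End fourier_sum.

(** Bessel's equality bounds every finite partial sum from above. Conversely, [x] is close to a
    finite combination of basis vectors; the projection onto those vectors is at least as close, so
    their partial sum nearly exhausts the squared norm. *)
Lemma parseval x : H x ->
  (\esum_(b in B) (sqnormc (inner b x))%:E = (complex.Re (inner x x))%:E)%E.
Proof.
move=> Hx; have HBP := ip_setB Hx.
apply/eqP; rewrite eq_le; apply/andP; split.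
  apply: ge_ereal_sup => _ [S [Sfin SB] <-].
  rewrite fsbig_finite// sumEFin lee_fin.
  have SB' : [set` fset_set S] `<=` B by rewrite fset_setK.
  rewrite (bessel_eq SB' Hx) raddfD /= lerDr.
  have := ip_ge0 ip (HBP _ (fourier_sum_in SB' x)).
  by rewrite lecE => /andP[].
apply/lee_addgt0Pr => e e0.
have [_ _ dense] := B_onb.
(* [inner_norm] is a square root: a distance below [Num.sqrt e] is a squared distance below [e]. *)
have se0 : 0 < Num.sqrt e by rewrite sqrtr_gt0.
have [_ [n [c [b [bB ->]]]]] := dense _ Hx _ se0.
rewrite /inner_norm ltr_sqrt// => le.
pose S := [fset b i | i in 'I_n]%fset.
have bS i : b i \in S by apply/imfsetP; exists i.
have SB : [set` S] `<=` B by move=> _ /= /imfsetP[i _ ->].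
apply: le_trans (leeD (esum_fset_le _ SB) (lexx _)).
rewrite sumEFin -EFinD lee_fin (bessel_eq SB Hx) raddfD /= addrC lerD2l.
apply: le_trans (ltW le).
by have := fourier_sum_best SB Hx c bS; rewrite lecE => /andP[].
Qed.

End parseval.

(** * Unconditional sums of complex families and convergence of the l^2 inner product *)

Section has_sum.
Variables (R : realType) (I : choiceType).
Implicit Types (g h : I -> R[i]^o) (l m : R[i]^o) (x y z : I -> R[i]^o).

Definition has_sum g l : Prop :=
  summability.partial_sum g @ summability.totally --> l.

#[local] Existing Instance summability.totally_filter.

Lemma partial_sumE g (J : {fset I}) :
  summability.partial_sum g J = \sum_(i <- J) g i.
Proof. by rewrite /summability.partial_sum big_seq_fsetE. Qed.

Lemma has_sum_sum g l : has_sum g l -> summability.sum g = l.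
Proof.
apply: (@cvg_lim (R[i]^o : normedModType R[i]) _ {fset I}
  summability.totally).
exact: norm_hausdorff.
Qed.

Lemma has_sum_lin (a : R[i]) g h l m :
  has_sum g l -> has_sum h m -> has_sum (fun i => a * g i + h i) (a * l + m).
Proof.
move=> gl hm; rewrite /has_sum.
have -> : summability.partial_sum (fun i => a * g i + h i : R[i]^o) =
    (fun J => a *: summability.partial_sum g J + summability.partial_sum h J).
  apply/funext => J.
  by rewrite !partial_sumE big_split /= -mulr_sumr.
exact: (cvgD (@cvgZl_tmp _ _ _ _ _ a _ _ gl) hm).
Qed.

Lemma has_sum_conj g l : has_sum g l -> has_sum (fun i => (g i)^*) l^*.
Proof.
move=> /cvgrPdist_lt gl; apply/cvgrPdist_lt => e e0.
apply: filterS (gl e e0) => J.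
by rewrite !partial_sumE -rmorph_sum -rmorphB /= norm_conjC.
Qed.

Lemma has_sum_finite g (J : {fset I}) :
  (forall i, i \notin J -> g i = 0) -> has_sum g (\sum_(i <- J) g i).
Proof.
move=> g0; apply: cvg_near_cst; exists J => // K /= JK.
rewrite partial_sumE (big_fsetID _ (mem J)) /= [X in _ + X]big1_fset ?addr0.
  apply: eq_fbigl => i; rewrite !inE /=.
  by apply/andP/idP => [[]//|iJ]; split => //; exact: (fsubsetP JK).
by move=> i; rewrite !inE /= => /andP[_ /g0].
Qed.

(** Turns summability into a uniform bound on finite sums, so that closure properties of l^2 follow
    from real inequalities. *)
Lemma esum_lty_bound (a : I -> R) :
  (forall i, 0 <= a i) ->
  (\esum_(i in [set: I]) (a i)%:E < +oo)%E <->
  exists M, forall J : {fset I}, \sum_(i <- J) a i <= M.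
Proof.
move=> a0; split => [afin|[M aM]].
  exists (fine (\esum_(i in [set: I]) (a i)%:E)%E) => J.
  rewrite -lee_fin -sumEFin fineK ?esum_fset_le//.
  by rewrite ge0_fin_numE// esum_ge0// => i _; rewrite lee_fin.
apply: (@le_lt_trans _ _ M%:E); last exact: ltry.
apply: ge_ereal_sup => _ [J [Jfin _] <-].
by rewrite fsbig_finite// sumEFin lee_fin.
Qed.

(** The extended sum is the supremum of the finite partial sums. Once one of them is within the
    tolerance, nonnegativity keeps all larger ones within it, so the net converges to the
    supremum. *)
Lemma has_sum_ge0 (a : I -> R) :
  (forall i, 0 <= a i) -> (\esum_(i in [set: I]) (a i)%:E < +oo)%E ->
  has_sum (fun i => (a i)%:C) (fine (\esum_(i in [set: I]) (a i)%:E)%E)%:C.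
Proof.
move=> a0 afin; set s := fine _.
have sE : (\esum_(i in [set: I]) (a i)%:E = s%:E)%E.
  by rewrite fineK// ge0_fin_numE// esum_ge0// => i _; rewrite lee_fin.
apply/cvgrPdist_lt => -[e e'] /= e0.
(* The tolerance is a complex number; being positive in [R[i]] forces its imaginary part to be 0. *)
have {e' e0} [-> e0] : e' = 0 /\ 0 < e.
  by move: e0; rewrite ltcE /= => /andP[/eqP -> ].
have : (s%:E - e%:E < ereal_sup [set \sum_(i \in A) (a i)%:E |
    A in fsets [set: I]])%E.
  by rewrite -[ereal_sup _]/(esum _ _) sE -EFinB lte_fin ltrBlDr ltrDl.
move=> /ereal_sup_gt[_ [A [Afin _] <-]].
rewrite fsbig_finite// sumEFin -EFinB lte_fin => sA.
exists (fset_set A) => // J /= AJ; rewrite partial_sumE.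
have Js : \sum_(i <- J) a i <= s.
  by rewrite -lee_fin -sumEFin -sE esum_fset_le.
have Jse : s - e < \sum_(i <- J) a i.
  apply: (lt_le_trans sA); rewrite (big_fsetID _ (mem (fset_set A)) J) /=.
  rewrite -[leLHS]addr0 lerD ?sumr_ge0//.
  rewrite le_eqVlt; apply/orP; left; apply/eqP; apply: eq_fbigl => i.
  rewrite !inE /=; apply/idP/andP => [iA|[]//].
  by split => //; exact: (fsubsetP AJ).
rewrite -rmorph_sum -rmorphB /= ger0_norm ?ler0c ?subr_ge0//.
by rewrite -complexr0 ltcR ltrBlDr addrC -ltrBlDr.
Qed.

(** Vectors are functions on all of [I] that vanish off [A], rather than functions on [A], so that a
    corner can be literally equal to such a space. *)
Definition ell2 (A : set I) : set (I -> R[i]^o) :=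
  [set x | (\esum_(i in [set: I]) (sqnormc (x i))%:E < +oo)%E /\
           forall i, ~ A i -> x i = 0].

(* Without the ascription, another normed module structure on R[i] is inferred
   than in sum_src. *)
Definition ell2_inner x y : R[i] :=
  summability.sum ((fun i => (x i)^* * y i) : I -> R[i]^o).

Lemma sqnormcReIm (c : R[i]) :
  sqnormc c = complex.Re c ^+ 2 + complex.Im c ^+ 2.
Proof.
by case: c => c d; rewrite /sqnormc /= sqr_sqrtr// addr_ge0 ?sqr_ge0.
Qed.

(** This is [|z + w|^2 <= 2 (|z|^2 + |w|^2)] with [z = a b] and [w = c], equivalent to
    [|z - w|^2 >= 0]. *)
Lemma sqnormc_lin_le (a b c : R[i]) :
  sqnormc (a * b + c) <= 2 * (sqnormc a * sqnormc b + sqnormc c).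
Proof.
have -> : sqnormc a * sqnormc b = sqnormc (a * b).
  by rewrite /sqnormc Normc.normcM exprMn.
rewrite !sqnormcReIm; case: (a * b) c => p q [r s] /=.
have := sqr_ge0 (p - r); have := sqr_ge0 (q - s); nra.
Qed.

Lemma ell2_lin A (a : R[i]) x y : ell2 A x -> ell2 A y -> ell2 A (a *: x + y).
Proof.
move=> [x2 xA] [y2 yA]; split => [|i nAi]; last first.
  by rewrite -[LHS]/(a * x i + y i) xA// yA// mulr0 addr0.
move: x2 y2; rewrite !esum_lty_bound => [[M xM] [N yN]|i|i|i];
  do ?exact: sqnormc_ge0.
exists (2 * (sqnormc a * M + N)) => J.
apply: le_trans (ler_sum _ (fun i _ => sqnormc_lin_le a (x i) (y i))) _.
rewrite -mulr_sumr ler_pM2l// big_split /= -mulr_sumr lerD//.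
by rewrite ler_wpM2l// sqnormc_ge0.
Qed.

(** The first two terms yield the real and imaginary parts of the product; the others remove the
    surplus squares. The nested shape, with its final [0], fits repeated use of [has_sum_lin]. *)
Lemma polarization (a b : R[i]) :
  a^* * b = 2^-1 * (sqnormc (1 * a + b))%:C +
    ('i / 2 * (sqnormc ('i * a + b))%:C +
     (- ((1 + 'i) / 2) * (sqnormc a)%:C +
      (- ((1 + 'i) / 2) * (sqnormc b)%:C + 0))).
Proof.
rewrite !sqnormcE !normCK !rmorphD !rmorphM !rmorph1 /= conjCi.
have i2 : 'i * 'i = -1 :> R[i] by rewrite -expr2 sqrCi.
by field: i2.
Qed.

(** Polarization writes the complex summand as a combination of four nonnegative families, each
    summable because [ell2 A] is closed under linear combinations. *)
Lemma has_sum_ell2 A x y : ell2 A x -> ell2 A y ->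
  has_sum (fun i => (x i)^* * y i) (ell2_inner x y).
Proof.
move=> x2 y2; suff [l xyl] : exists l, has_sum (fun i => (x i)^* * y i) l.
  by rewrite /ell2_inner (has_sum_sum xyl).
have sq z : ell2 A z -> has_sum (fun i => (sqnormc (z i))%:C)
    (fine (\esum_(i in [set: I]) (sqnormc (z i))%:E)%E)%:C.
  by move=> [z2 _]; apply: has_sum_ge0 => // i; exact: sqnormc_ge0.
under [X in has_sum X]eq_fun do rewrite polarization.
eexists; apply: has_sum_lin; first exact: (sq _ (ell2_lin 1 x2 y2)).
apply: has_sum_lin; first exact: (sq _ (ell2_lin 'i x2 y2)).
apply: has_sum_lin; first exact: (sq _ x2).
apply: has_sum_lin; first exact: (sq _ y2).
(* The remaining summand is the final [0] of [polarization], whose sum is the empty one. *)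
by apply: (@has_sum_finite _ fset0).
Qed.

End has_sum.

(** * Orthonormal bases of l^2 and their cardinality *)

Section ell2.
Variables (R : realType) (I : choiceType) (A : set I).
Implicit Types (x y z : I -> R[i]^o).

Lemma ell2_inner_self x : ell2 A x ->
  ell2_inner x x =
  (fine (\esum_(i in [set: I]) (sqnormc (x i))%:E)%E)%:C.
Proof.
move=> [x2 _]; apply: has_sum_sum.
under [X in has_sum X]eq_fun do rewrite mulrC -normCK -sqnormcE.
by apply: has_sum_ge0 => // i; exact: sqnormc_ge0.
Qed.

Lemma ell2_inner_product_on :
  inner_product_on (@ell2_inner R I) (ell2 A).
Proof.
split.
- split => //; rewrite esum1 ?ltry// => i _.
  by rewrite /sqnormc Normc.normc0 expr0n.
- exact: ell2_lin.
- move=> a x y z x2 y2 z2; apply: has_sum_sum.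
  have := @has_sum_lin _ _ a _ _ _ _ (has_sum_ell2 x2 y2) (has_sum_ell2 x2 z2).
  congr has_sum; apply/funext => i.
  by rewrite -[(a *: y + z) i]/(a * y i + z i) mulrDr mulrCA.
- move=> x y x2 y2; apply: has_sum_sum.
  have := has_sum_conj (has_sum_ell2 x2 y2).
  congr has_sum; apply/funext => i.
  by rewrite rmorphM /= conjCK mulrC.
- move=> x x2; rewrite ell2_inner_self// ler0c fine_ge0// esum_ge0// => i _.
  by rewrite lee_fin sqnormc_ge0.
Qed.

Definition delta (i : I) : I -> R[i]^o := fun j => (j == i)%:R.

Lemma ell2_delta i : A i -> ell2 A (delta i).
Proof.
move=> Ai; split => [|j nAj]; last first.
  by rewrite /delta; case: eqP => // ji; rewrite ji in nAj.
apply/esum_lty_bound => [j|]; first exact: sqnormc_ge0.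
exists 1 => J; have [iJ|iJ] := boolP (i \in J); last first.
  rewrite big_seq big1// => j jJ; rewrite /delta (negbTE (memPn iJ j jJ)).
  by rewrite /sqnormc Normc.normc0 expr0n.
rewrite (bigD1_seq i)//= big1 ?addr0 => [|j ji]; rewrite /delta.
  by rewrite eqxx /sqnormc Normc.normc1 expr1n.
by rewrite (negbTE ji) /sqnormc Normc.normc0 expr0n.
Qed.

Lemma ell2_inner_delta x i : ell2_inner x (delta i) = (x i)^*.
Proof.
rewrite /ell2_inner.
rewrite (@has_sum_sum _ _ _ (\sum_(j <- [fset i]%fset) (x j)^* * delta i j)).
  by rewrite big_seq_fset1 /delta eqxx mulr1.
apply: has_sum_finite => j; rewrite inE => ji.
by rewrite /delta (negbTE ji) mulr0.
Qed.

Lemma sqnormc_conj (c : R[i]) : sqnormc c^* = sqnormc c.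
Proof. by apply: (@complexI R); rewrite !sqnormcE norm_conjC. Qed.

Lemma ell2_basis_card (B : set (I -> R[i]^o)) :
  countable A -> orthonormal_basis (@ell2_inner R I) (ell2 A) B -> A #= B.
Proof.
move=> Acnt B_onb; have [BA Bo _] := B_onb.
apply: (@card_eq_doubly_stochastic R _ _ _ _
  (fun i b => (sqnormc (b i))%:E)) => // [i b|i Ai|b Bb].
- by rewrite lee_fin sqnormc_ge0.
(* Rows: the coefficient of [delta i] at [b] is the value [b i] up to conjugation, and [delta i] has
   norm 1. *)
- have := parseval ell2_inner_product_on B_onb (ell2_delta Ai).
  rewrite ell2_inner_delta {2}/delta eqxx conjC1 /= => <-.
  by apply: eq_esum => b _; rewrite ell2_inner_delta sqnormc_conj.
- have [b2 bA] := BA _ Bb.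
  have := ell2_inner_self (BA _ Bb); rewrite Bo// eqxx => -[/esym b1].
  rewrite -[RHS]/(1%:E) -b1 fineK; last first.
    by rewrite ge0_fin_numE// esum_ge0// => i _; rewrite lee_fin sqnormc_ge0.
  (* Columns: the unit norm of [b] is a sum over all of [I], and [b] vanishes off [A]. *)
  rewrite esum_mkcond; apply: eq_esum => i _.
  case: ifPn => // /negP iA; rewrite bA; last by move=> /mem_set.
  by rewrite /sqnormc Normc.normc0 expr0n.
Qed.

End ell2.

(** * Corners of the graph correspondence as l^2 spaces *)

Section corner.
Variables (R : realType) (V : choiceType) (F : digraph V) (u v : V).

Lemma pt_projE (w x : V) : pt_proj R w x = (x == w)%:R.
Proof.
rewrite /pt_proj indicE; congr (_%:R : R[i]); congr nat_of_bool.
by apply/idP/eqP => [/set_mem//|->]; rewrite mem_set.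
Qed.

Definition edges_between : set (edge F) := [set f | rng f = u /\ src f = v].

(** Acting by [p_u] and [p_v] multiplies by the indicator of [edges_between]. Conversely, a
    square-summable function supported there is fixed by this action, and it lies in the
    correspondence because its source norms are concentrated at [v]. *)
Lemma corner_ell2 : corner u v = ell2 edges_between :> set (edge F -> R[i]^o).
Proof.
apply/seteqP; split => [_ [xi [xi2 _] <-]|xi [xi2 xiA]].
  have supp f : ~ edges_between f ->
      graph_act (pt_proj R u) xi (pt_proj R v) f = 0.
    move=> nf; rewrite /graph_act !pt_projE.
    case: eqP => [fu|_]; last by rewrite !mul0r.
    case: eqP => [fv|_]; last by rewrite mulr0.
    by case: nf.
  split => //; apply: le_lt_trans (xi2 v).
  rewrite /sqnorm_src [leRHS]esum_mkcond; apply: le_esum => f _.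
  have [[fu fv]|nf] := pselect (edges_between f); last first.
    rewrite supp// /sqnormc Normc.normc0 expr0n; case: ifP => // _.
    by rewrite lee_fin sqr_ge0.
  rewrite mem_set// /graph_act !pt_projE fu fv !eqxx.
  by rewrite mul1r mulr1.
have sq0 w f : w <> v -> src f = w -> sqnormc (xi f) = 0.
  move=> wv fw; rewrite xiA ?/sqnormc ?Normc.normc0 ?expr0n// => -[_ fv].
  by apply: wv; rewrite -fw.
have norm0 w : w <> v -> sqnorm_src xi w = 0%E.
  move=> wv; rewrite /sqnorm_src esum1// => f fw.
  by rewrite -/(sqnormc _) (sq0 w).
exists xi; last first.
  apply/funext => f; rewrite /graph_act !pt_projE.
  have [[-> ->]|nf] := pselect (edges_between f).
    by rewrite !eqxx mul1r mulr1.
  by rewrite xiA// mulr0 mul0r.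
split => [w|eps eps0].
  apply: le_lt_trans xi2; rewrite /sqnorm_src [leLHS]esum_mkcond.
  by apply: le_esum => f _; case: ifP => // _; rewrite lee_fin sqnormc_ge0.
(* The source norm vanishes at every vertex other than [v], so the set tested by [c0] is contained
   in a singleton. *)
apply: (@sub_finite_set _ _ [set v]); last exact: finite_set1.
move=> w /=; have [->//|/eqP wv] := eqVneq w v.
by rewrite norm0// normr0 lecR leNgt eps0.
Qed.

(** Since [eta] vanishes off the edges from [v] to [u], restricting the sum to edges with source [v]
    changes no term. *)
Lemma corner_innerE (xi eta : edge F -> R[i]^o) : corner u v eta ->
  corner_inner v xi eta = ell2_inner xi eta.
Proof.
rewrite corner_ell2 => -[_ eta0].
rewrite /corner_inner /graph_inner /sum_src /ell2_inner; 
  apply: (congr1 (fun g : edge F -> R[i]^o => summability.sum g : R[i])).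
apply/funext => f; case: eqP => // fv.
by rewrite eta0 ?mulr0// => -[].
Qed.

Lemma corner_basis_card (B : set (edge F -> R[i]^o)) :
  countable [set: edge F] ->
  orthonormal_basis (corner_inner v) (corner u v) B -> edges_between #= B.
Proof.
move=> Fcnt [BC Bo Bd]; apply: (@ell2_basis_card R).
  exact: sub_countable (subset_card_le (@subsetT _ _)) Fcnt.
have ip := @ell2_inner_product_on R (edge F) edges_between.
rewrite -corner_ell2 in ip *; split => // [x y Bx By|x Cx eps eps0].
  by rewrite -corner_innerE ?Bo//; exact: BC.
have [y [n [c [b [bB ->]]]] xy] := Bd x Cx eps eps0.
exists (\sum_(i < n) c i *: b i); first by exists n, c, b.
(* The two inner products are compared at [x - y], so this difference must lie in the corner. *)
move: xy; rewrite /inner_norm corner_innerE//.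
by apply: (ip_setB ip) => //; apply: (ip_set_sum ip) => i _; exact: BC.
Qed.

End corner.

(** * Gluing the bijections of all pairs of vertices *)

Arguments edges_between {V} F u v.

Theorem proposition1p4 (R : realType) (V : choiceType) (F : digraph V)
    (V_countable : countable [set: V]) (F_countable : countable [set: edge F])
    (B : V -> V -> set (edge F -> R[i]^o))
    (B_onb : forall u v : V,
       orthonormal_basis (corner_inner v) (corner u v) (B u v)) :
  iso_fixing_vertices (basis_graph B) F.
Proof.
have g_ex : forall uv : V * V, exists g : B uv.1 uv.2 ->
    edges_between F uv.1 uv.2, bijective g.
  move=> [u v] /=.
  have /card_esym/card_eqP[g] := corner_basis_card F_countable (B_onb u v).
  by exists g; exact: bijTT.
pose g uv := projT1 (cid (g_ex uv)).
have g_bij uv : bijective (g uv) := projT2 (cid (g_ex uv)).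
pose phi (e : edge (basis_graph B)) : edge F :=
  set_val (g (tag e) (tagged e)).
exists phi.
have ends (e : edge (basis_graph B)) :
    rng (phi e) = (tag e).1 /\ src (phi e) = (tag e).2.
  exact: (set_valP (g (tag e) (tagged e))).
split; last by [].
rewrite -setTT_bijective; split => // [e e' _ _|f _].
  move=> ee'; have [re se] := ends e; have [re' se'] := ends e'.
  (* The tag of an edge is recovered from the ends of its image, so injectivity reduces to that of a
     single [g uv]. *)
  have : tag e = tag e'.
    by apply: injective_projections; rewrite -?re -?se ee' ?re' ?se'.
  case: e e' ee' {re se re' se'} => [uv x] [uv' x'] /= phiE uvE.
  by subst uv'; congr existT; exact: (bij_inj (g_bij uv) (val_inj phiE)).
(* Every [f] lies in the block indexed by its own ends, and the inverse of that block's bijection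
   supplies the preimage. *)
have fA : edges_between F (rng f, src f).1 (rng f, src f).2 f by [].
have [h _ gh] := g_bij (rng f, src f).
exists (existT _ (rng f, src f) (h (SigSub (mem_set fA)))) => //=.
by rewrite /phi [g _ _]gh.
Qed.
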